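(* For any (discrete) sensor field in a region $\Omega$, and for any fixed target shape, let $h'$ be the height function which is the return of the sensor field when each sensor has a target centered over it. Let $H=\int_\Omega h'\,d\chi$. Let $\alpha$ be the number of sensors in the sensor field. Then when $n$ targets (of the fixed shape) are uniformly and discretely put down on the sensor field, where $n=m\cdot\alpha$ for some positive integer $m$, and where $h$ is the height function coming off this sensor field, we have $$\mathrm{E}\left(\int_\Omega h\,d\chi\right)=Hm,\quad\text{as } n\to\infty .$$
   Context: Sensor field: a finite collection of square sensors of dimension $1\times1$, arranged in a regular grid in the plane with no overlap and no space among their sensing squares. The union of the sensing squares is the region $\Omega\subset\mathbb{R}^2$. Each sensor detects without error the number of targets above it. Targets are subsets of the plane. There is no sensing along the boundaries of the sensing squares, so a target without width lying entirely along such boundaries is not detected. Height function: for a placement of finitely many targets, the height function $h$ at a point $x\in\Omega$ not on the boundary of any sensing square is the total number of targets above the sensor whose sensing square contains $x$. For $x$ on the boundary of a sensing square, $h(x)$ agrees with the value returned by the sensor underneath or to the left of $x$. Placement: ''uniformly and discretely put down'' means that the targets are placed independently, each centered over the center of a sensor chosen uniformly at random among the $\alpha$ sensors. Discrete Euler characteristic integral: extend $h$ by $0$ to all of $\mathbb{R}^2$ (zero-padding). Then $$\int_\Omega h\,d\chi:=\sum_{s=0}^\infty\left(\beta_0\{h>s\}-\beta_0\{h\le s\}+1\right),$$ where $\{h>s\}=\{x\in\mathbb{R}^2:h(x)>s\}$, $\{h\le s\}=\{x\in\mathbb{R}^2:h(x)\le s\}$, and $\beta_0$ denotes the zeroth Betti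 number, i.e. the number of connected components of the set. $\mathrm{E}$ denotes expectation. *)

(* Defs.v *)
From HB Require Import structures.
From mathcomp Require Import all_boot all_order all_algebra finmap.
From mathcomp Require Import all_classical all_reals all_analysis.

Set Implicit Arguments.
Unset Strict Implicit.
Unset Printing Implicit Defensive.

Import Order.TTheory GRing.Theory Num.Theory.
Import numFieldNormedType.Exports.

Local Open Scope classical_set_scope.
Local Open Scope ring_scope.

(* A sensor field is a finite set S of cells of the unit grid; the cell
   (i, j) : int * int is the sensor whose sensing square is
   [i, i + 1] x [j, j + 1]. *)
Definition cell : Type := (int * int)%type.

Section SensorField.
Variable R : realType.
Local Notation plane := (R * R)%type.

Definition open_square (c : cell) : set plane :=
  `]c.1%:~R, (c.1 + 1)%:~R[%classic `*` `]c.2%:~R, (c.2 + 1)%:~R[%classic.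

Definition square_center (c : cell) : plane :=
  (c.1%:~R + 2^-1, c.2%:~R + 2^-1).

(* The cell (i, j) with i < x.1 <= i + 1 and j < x.2 <= j + 1: at a point of a
   grid line this is the cell to the left of, resp. underneath, x. *)
Definition cell_of (x : plane) : cell :=
  (Num.ceil x.1 - 1, Num.ceil x.2 - 1).

(* The shape is given in coordinates having its center at the origin. *)
Definition target_at (shape : set plane) (c : cell) : set plane :=
  [set square_center c + x | x in shape].

(* Number of the targets tgt k lying above the sensor c. Meeting the open
   square is required because nothing is sensed along the boundary. *)
Definition sensor_count (I : finType) (tgt : I -> set plane) (c : cell) : nat :=
  #|[pred k | `[< tgt k `&` open_square c !=set0 >]]|.

(* Already extended by 0 outside of the sensor field S. *)
Definition height (S : {fset cell}) (I : finType) (tgt : I -> set plane)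
    (x : plane) : nat :=
  if cell_of x \in S then sensor_count tgt (cell_of x) else 0%N.

(* Number of connected components; fset_set makes it 0 if there are infinitely
   many, which does not happen for level sets of height functions (finite
   unions of squares, and complements of such unions). *)
Definition betti0 (A : set plane) : nat :=
  #|` fset_set (connected_component A @` A) |.

Definition euler_integral (h : plane -> nat) : R :=
  limn (series (fun s : nat =>
    (betti0 [set x | (s < h x)%N])%:R
    - (betti0 [set x | (h x <= s)%N])%:R + 1 : R)).

(* X k is the sensor over which the k-th target is centered. The second
   condition is uniformity, the third one is mutual independence. *)
Definition uniform_placement d (T : measurableType d) (P : probability T R)
    (S : {fset cell}) (n : nat) (X : 'I_n -> T -> S) : Prop :=
  [/\ forall (k : 'I_n) (A : set S), measurable (X k @^-1` A),
      forall (k : 'I_n) (c : S), P (X k @^-1` [set c]) = (#|` S|%:R^-1)%:E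
    & forall (J : {set 'I_n}) (A : 'I_n -> set S),
        P (\bigcap_(k in [set` J]) (X k @^-1` A k))
        = (\prod_(k in J) P (X k @^-1` A k))%E].

End SensorField.

(* Main.v *)
(* The Euler integral of a height function depends only on the vector u of
   sensor counts: it equals F u = sum_s f {c | s < u c}, the Choquet integral of
   the set function f A = betti0 (region A) - betti0 (complement of region A) + 1.
   The only topology needed is that f vanishes at the empty set, because the
   plane is connected. Choquet integrals on a finite set are homogeneous,
   F (m u) = m F u, and Lipschitz in u for the l1 distance. With m * alpha
   uniform targets each count has mean m u', where u' is the vector of counts for
   one target per sensor, and variance O(m). Hence
   |E (F u) - m F u'| = O(sqrt m). *)
Require Import Defs.
From HB Require Import structures.
From mathcomp Require Import all_boot all_order all_algebra finmap.
From mathcomp Require Import all_classical all_reals all_analysis.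
From mathcomp Require Import ring lra.

Set Implicit Arguments.
Unset Strict Implicit.
Unset Printing Implicit Defensive.

Import Order.TTheory GRing.Theory Num.Theory.
Import numFieldNormedType.Exports.

Local Open Scope classical_set_scope.
Local Open Scope ring_scope.

(** * Choquet integrals on a finite set *)

Section ChoquetIntegral.
Variables (R : realType) (I : finType) (f : {set I} -> R).
Hypothesis f0 : f finset.set0 = 0.

Definition superlevel (u : I -> nat) (s : nat) : {set I} :=
  [set c | (s < u c)%N]%SET.

Definition choquet (u : I -> nat) : R :=
  \sum_(0 <= s < (\max_c u c)%N) f (superlevel u s).

Lemma superlevel_set0 (u : I -> nat) (s : nat) :
  (\max_c u c <= s)%N -> superlevel u s = finset.set0.
Proof.
move=> us; apply/setP => c; rewrite !inE ltnNge.
by rewrite (leq_trans _ us) // leq_bigmax.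
Qed.

Lemma choquet_widen (u : I -> nat) (N : nat) :
  (\max_c u c <= N)%N ->
  choquet u = \sum_(0 <= s < N) f (superlevel u s).
Proof.
move=> uN; rewrite (big_cat_nat (n := (\max_c u c)%N)) //=.
rewrite [X in _ + X]big_nat_cond [X in _ + X]big1 ?addr0// => s.
by rewrite andbT => /andP[us _]; rewrite superlevel_set0.
Qed.

(** Each level [N] of [u] unfolds into the [m] levels [m * N + r], [r < m], of [m * u], all with the
    same superlevel set. *)
Lemma choquetZ (m : nat) (u : I -> nat) :
  choquet (fun c => m * u c)%N = m%:R * choquet u.
Proof.
have [->|m_gt0] := posnP m.
  by rewrite mul0r /choquet big1_eq big_geq.
rewrite (@choquet_widen _ (m * \max_c u c)%N); last first.
  by apply/bigmax_leqP => c _; rewrite leq_mul2l leq_bigmax orbT.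
rewrite /choquet; elim: (\max_c u c)%N => [|N IHN].
  by rewrite muln0 !big_geq ?mulr0.
rewrite mulnS addnC (big_cat_nat (n := (m * N)%N)) ?leq_addr//= IHN.
rewrite big_nat_recr//= mulrDr; congr (_ + _).
rewrite -{1}[(m * N)%N]add0n big_addn addnC addnK.
rewrite (eq_big_nat _ _ (F2 := fun=> f (superlevel u N))); last first.
  move=> r /andP[_ rm]; congr f; apply/setP => c; rewrite !inE.
  apply/idP/idP => [h|h]; last first.
    have : (m * N.+1 <= m * u c)%N by rewrite leq_mul2l h orbT.
    by apply: leq_trans; rewrite mulnS ltn_add2r.
  by rewrite -(ltn_pmul2l m_gt0) (leq_ltn_trans _ h)// leq_addl.
by rewrite sumr_const_nat subn0 mulr_natl.
Qed.

(** Layer-cake form of the distance: the levels separating [a] from [b] run from the smaller up to,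
    but excluding, the larger. *)
Lemma sum_ltn_neq (a b N : nat) : (a <= N)%N -> (b <= N)%N ->
  \sum_(0 <= s < N) ((s < a) != (s < b))%N%:R = `|a%:R - b%:R| :> R.
Proof.
wlog ab : a b / (a <= b)%N => [hw aN bN|aN bN].
  have [ab|/ltnW ba] := leqP a b; first exact: hw.
  by rewrite distrC -hw//; apply: eq_bigr => s _; rewrite eq_sym.
rewrite (big_cat_nat (n := b)) //= (big_cat_nat (n := a)) //=.
rewrite [X in X + _ + _]big_nat_cond [X in X + _ + _]big1; last first.
  by move=> s; rewrite andbT => /andP[_ sa]; rewrite sa (leq_trans sa ab).
rewrite [X in _ + X]big_nat_cond [X in _ + X]big1; last first.
  move=> s; rewrite andbT => /andP[bs _].
  by rewrite !ltnNge bs (leq_trans ab bs).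
rewrite (eq_big_nat _ _ (F2 := fun=> 1)); last first.
  by move=> s /andP[as_ sb]; rewrite sb ltnNge as_.
by rewrite sumr_const_nat add0r addr0 distrC -natrB// normr_nat.
Qed.

(** At a level where the two superlevel sets differ, the values of [f] differ by at most [2 * C],
    and some [c] separated by that level contributes 1 to the l1 distance. *)
Lemma choquet_lipschitz (u v : I -> nat) :
  `|choquet u - choquet v| <=
    2 * (\sum_A `|f A|) * \sum_c `|(u c)%:R - (v c)%:R|.
Proof.
set C := \sum_A `|f A|.
have fC A : `|f A| <= C by rewrite /C (bigD1 A)//= lerDl sumr_ge0.
have C0 : 0 <= C by apply: sumr_ge0.
pose N := maxn (\max_c u c) (\max_c v c).
have uN c : (u c <= N)%N by rewrite leq_max (leq_bigmax (F := u)).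
have vN c : (v c <= N)%N by rewrite leq_max (leq_bigmax (F := v)) orbT.
rewrite (@choquet_widen u N) ?leq_maxl// (@choquet_widen v N) ?leq_maxr//.
rewrite -sumrB (le_trans (ler_norm_sum _ _ _))//.
under [X in _ <= _ * X]eq_bigr => c _ do rewrite -(sum_ltn_neq (uN c) (vN c)).
rewrite exchange_big/= mulr_sumr; apply: ler_sum => s _.
have [->|] := eqVneq (superlevel u s) (superlevel v s).
  by rewrite subrr normr0 !mulr_ge0// sumr_ge0.
move=> neq; have [c uv_c] : exists c, (s < u c)%N != (s < v c)%N.
  apply/existsP; rewrite -negb_forall; apply: contra neq => /forallP h.
  by apply/eqP/setP => c; rewrite !inE (eqP (h c)).
rewrite (le_trans (ler_normB _ _))// (@le_trans _ _ (2 * C * 1))//.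
  by rewrite mulr1 mulr_natl mulr2n lerD.
rewrite ler_wpM2l ?mulr_ge0// (bigD1 c)//= uv_c lerDl.
by rewrite sumr_ge0.
Qed.

End ChoquetIntegral.

(** * Euler integrals of heights as Choquet integrals *)

Section EulerIntegral.
Variable R : realType.

Lemma plane_connected : connected [set: R * R].
Proof.
have -> : [set: R * R] =
    \bigcup_(p in [set: R * R]) [set t *: p | t in [set: R]].
  by apply/seteqP; split => // p _; exists p => //; exists 1; rewrite ?scale1r.
apply: bigcup_connected => [|p _].
  by exists 0 => p _; exists 0; rewrite ?scale0r.
apply: connected_continuous_connected; first exact/connected_intervalP.
by apply: continuous_subspaceT => t; apply: scalel_continuous.
Qed.

Lemma betti0_set0 : betti0 (set0 : set (R * R)) = 0%N.
Proof. by rewrite /betti0 image_set0 fset_set0. Qed.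

Lemma betti0_setT : betti0 [set: R * R] = 1%N.
Proof.
rewrite /betti0.
suff -> : connected_component [set: R * R] @` setT = [set setT].
  by rewrite fset_set1 cardfs1.
apply/seteqP; split => [_ [x _ <-]|_ ->] /=.
  by rewrite connected_component_id//; exact: plane_connected.
by exists 0 => //; rewrite connected_component_id//; exact: plane_connected.
Qed.

Variable S : {fset cell}.

(** A union of squares []i, i + 1] x ]j, j + 1]], half-open because [cell_of] rounds up. *)
Definition region (A : {set S}) : set (R * R) :=
  [set x | exists2 c, c \in A & val c = cell_of x].

Definition region_chi (A : {set S}) : R :=
  (betti0 (region A))%:R - (betti0 (~` region A))%:R + 1.

Lemma region_chi_set0 : region_chi finset.set0 = 0.
Proof.
have region0 : region finset.set0 = set0.
  by apply/seteqP; split => // x [c]; rewrite inE.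
by rewrite /region_chi region0 setC0 betti0_set0 betti0_setT; ring.
Qed.

Lemma height_superlevel (I : finType) (tgt : I -> set (R * R)) (s : nat) :
  [set x | (s < height S tgt x)%N] =
  region (superlevel (fun c => sensor_count tgt (val c)) s).
Proof.
apply/seteqP; split => [x|x [c]] /=; rewrite /height; last first.
  by rewrite inE => sc <-; rewrite (valP c).
case: ifPn => // xS sx; exists [` xS]%fset => //.
by rewrite inE.
Qed.

Lemma euler_integral_height (I : finType) (tgt : I -> set (R * R)) :
  euler_integral (height S tgt) =
  choquet region_chi (fun c => sensor_count tgt (val c)).
Proof.
set u := fun c : S => sensor_count tgt (val c).
(* From the largest count on, superlevel sets are empty and the terms vanish, so the partial sums
   are eventually constant. *)
apply: lim_near_cst => //; exists (\max_c u c)%N => //= N uN.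
rewrite (choquet_widen region_chi_set0 uN) /series/=.
apply: eq_bigr => s _; rewrite /region_chi -height_superlevel.
congr (_ - (betti0 _)%:R + 1).
by apply/seteqP; split => x /=;
  [rewrite leqNgt => /negP | move=> /negP; rewrite -leqNgt].
Qed.

End EulerIntegral.

(** * Joint law of a uniform placement *)

Section UniformPlacement.
Variables (R : realType) (d : measure_display) (T : measurableType d).
Variables (P : probability T R) (S : {fset cell}) (n : nat).
Variables (X : 'I_n -> T -> S) (X_unif : uniform_placement P X).

(** Uniformity and independence give every assignment [g] of targets to sensors the same
    probability; expectations become finite averages. *)
Lemma expectation_uniform_placement (G : {ffun 'I_n -> S} -> R) :
  ('E_P[fun w => G [ffun k => X k w]])%E =
  ((#|` S|%:R^-1 ^+ n) * \sum_g G g)%:E.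
Proof.
have [mX PX indepX] := X_unif.
pose D (g : {ffun 'I_n -> S}) :=
  \bigcap_(k in [set` [set: 'I_n]%SET]) (X k @^-1` [set g k]).
have mD g : measurable (D g) by apply: fin_bigcap_measurable.
have PD g : P (D g) = (#|` S|%:R^-1 ^+ n)%:E.
  rewrite /D (indepX _ (fun k => [set g k])).
  under eq_bigr do rewrite PX.
  rewrite prodEFin; congr EFin.
  by rewrite prodr_const cardsT card_ord.
have DE g w : D g w <-> g = [ffun k => X k w].
  split=> [Dw|-> k _ /=]; last by rewrite ffunE.
  by apply/ffunP => k; rewrite ffunE (Dw k)//= inE.
rewrite unlock.
(* The events [D g] partition the sample space, so the integrand is a finite combination of
   indicators. *)
transitivity (\int[P]_w (\sum_g (G g)%:E * (\1_(D g) w)%:E))%E.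
  apply: eq_integral => w _.
  rewrite (bigD1 [ffun k => X k w])//= big1 ?adde0.
    by rewrite indicE mem_set ?mule1//; exact/DE.
  by move=> g gX; rewrite indicE memNset ?mule0// => /DE/eqP; apply/negP.
rewrite integral_sum//; last first.
  by move=> g; apply: integrableZl => //; exact: integrable_indic.
rewrite mulr_sumr -sumEFin; apply: eq_bigr => g _.
rewrite integralZl//; last exact: integrable_indic.
by rewrite integral_indic// setIT mulrC EFinM; congr (_ * _)%E; exact: PD.
Qed.

End UniformPlacement.

(** * Second moment of a centered sum *)

Section FiniteVariance.
Variables (R : realFieldType) (I : finType) (n : nat) (a : I -> R).
Hypotheses (a_mean0 : \sum_c a c = 0) (a_le1 : forall c, `|a c| <= 1).

(* For a uniform random [g], the [a (g k)] are independent and centered, hence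
   uncorrelated. *)
Lemma sum_ffun_mul (k l : 'I_n) : k != l ->
  \sum_(g : {ffun 'I_n -> I}) a (g k) * a (g l) = 0.
Proof.
(* Padding with factors 1 gives a product over all indices; distributivity then factors the sum, and
   the factor at [k] is [\sum_c a c = 0]. *)
move=> kl; pose F i c := if (i == k) || (i == l) then a c else 1.
transitivity (\sum_(g : {ffun 'I_n -> I}) \prod_i F i (g i)).
  apply: eq_bigr => g _; rewrite (bigD1 k)//= (bigD1 l) 1?eq_sym//=.
  rewrite {1 2}/F !eqxx orbT/= big1 ?mulr1// => i /andP[/negPf ik /negPf il].
  by rewrite /F ik il.
rewrite -bigA_distr_bigA (bigD1 k)//=.
by rewrite (eq_bigr a) ?a_mean0 ?mul0r// => c _; rewrite /F eqxx.
Qed.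

(** Cross terms vanish by [sum_ffun_mul]; each of the [n] diagonal terms averages at most 1. *)
Lemma sum_ffun_sqr :
  \sum_(g : {ffun 'I_n -> I}) (\sum_k a (g k)) ^+ 2 <= n%:R * #|I|%:R ^+ n.
Proof.
under eq_bigr => g _.
  rewrite expr2 mulr_suml; under eq_bigr do rewrite mulr_sumr.
  over.
rewrite exchange_big/=.
rewrite (@le_trans _ _ (\sum_(k < n) #|I|%:R ^+ n))//; last first.
  by rewrite sumr_const card_ord mulr_natl.
apply: ler_sum => k _; rewrite exchange_big/= (bigD1 k)//= [X in _ + X]big1.
  rewrite addr0 (@le_trans _ _ (\sum_(g : {ffun 'I_n -> I}) 1))//.
    apply: ler_sum => g _.
    by rewrite -expr2 -real_normK ?num_real// exprn_ile1.
  by rewrite sumr_const card_ffun card_ord natrX.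
by move=> l lk; rewrite sum_ffun_mul// eq_sym.
Qed.

End FiniteVariance.

(** * Mean absolute deviation of a count *)

Section UniformMean.
Variables (R : rcfType) (I : finType).
Hypothesis I_gt0 : (0 < #|I|)%N.

Lemma sum_ffun_count_deviation (m n : nat) (B : pred I) :
  (0 < m)%N -> n = (m * #|I|)%N ->
  \sum_(g : {ffun 'I_n -> I})
    `|#|[pred k | B (g k)]|%:R - (m * #|B|)%N%:R|
  <= #|I|%:R ^+ n * ((#|I|%:R + 1) * Num.sqrt m%:R) :> R.
Proof.
move=> m_gt0 ->; set q : R := #|I|%:R; set t : R := Num.sqrt m%:R.
pose p := #|B|%:R / q.
have q_gt0 : 0 < q by rewrite ltr0n.
have t_gt0 : 0 < t by rewrite sqrtr_gt0 ltr0n.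
have tt : t ^+ 2 = m%:R by rewrite sqr_sqrtr ?ler0n.
have Bq : p <= 1 by rewrite /p ler_pdivrMr// mul1r ler_nat max_card.
have Bq0 : 0 <= p by rewrite divr_ge0// ltW.
(* The indicator of [B], centered by its mean [p] under the uniform law. *)
pose a c : R := (B c)%:R - p.
have a0 : \sum_c a c = 0.
  rewrite sumrB sumr_const -[X in _ - X]mulr_natl mulrCA divff ?gt_eqF// mulr1.
  suff -> : \sum_c (B c)%:R = #|B|%:R :> R by rewrite subrr.
  by rewrite -natr_sum -sum1_card [in RHS]big_mkcond.
have a1 c : `|a c| <= 1 by rewrite /a ler_norml; case: (B c) => /=; lra.
have devE (g : {ffun 'I_(m * #|I|) -> I}) :
    #|[pred k | B (g k)]|%:R - (m * #|B|)%N%:R = \sum_k a (g k).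
  have -> : (m * #|B|)%N%:R = p *+ (m * #|I|).
    by rewrite -mulr_natr /p !natrM -/q; field; rewrite gt_eqF.
  rewrite sumrB sumr_const card_ord -natr_sum -sum1_card big_mkcond/=.
  by congr (_%:R - _); apply: eq_bigr => k _; rewrite inE; case: (B _).
(* Used in place of Cauchy-Schwarz: the averages of [y ^+ 2] are at most [m * #|I|], so [t = sqrt m]
   makes both terms of order [sqrt m]. *)
have abs_le (y : R) : `|y| <= t^-1 * y ^+ 2 + t.
  rewrite -(ler_pM2l t_gt0) mulrDr mulVKf ?gt_eqF// -(real_normK (num_real y)).
  by have := sqr_ge0 (`|y| - t); have := sqr_ge0 `|y|; have := sqr_ge0 t; nra.
under eq_bigr do rewrite devE.
apply: (@le_trans _ _ (\sum_(g : {ffun 'I_(m * #|I|) -> I})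
    (t^-1 * (\sum_k a (g k)) ^+ 2 + t))); first exact: ler_sum.
rewrite big_split/= -mulr_sumr sumr_const card_ffun card_ord.
apply: (@le_trans _ _ (t^-1 * ((m * #|I|)%N%:R * q ^+ (m * #|I|)) +
    t *+ #|I| ^ (m * #|I|))).
  by rewrite lerD2r ler_pM2l ?invr_gt0//; exact: sum_ffun_sqr.
rewrite -[t *+ _]mulr_natl natrX -/q natrM -/q -tt le_eqVlt; apply/orP; left.
by apply/eqP; field; rewrite gt_eqF.
Qed.

End UniformMean.

(** * Convergence of the normalized expectation *)

Section Expectation.
Variables (R : realType) (S : {fset cell}) (shape : set (R * R)).

(** [c] is the sensor and [c'] the position of the target, so [#|detects c|] is the count at [c]
    with one target per sensor. *)
Definition detects (c c' : S) : bool :=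
  `[< target_at shape (val c') `&` open_square (val c) !=set0 >].

Lemma euler_integral_placement (n : nat) (x : 'I_n -> S) :
  euler_integral (height S (fun k => target_at shape (val (x k)))) =
  choquet (@region_chi R S) (fun c => #|[pred k | detects c (x k)]|).
Proof. exact: euler_integral_height. Qed.

Lemma euler_integral_one_per_sensor :
  euler_integral (height S (fun c : S => target_at shape (val c))) =
  choquet (@region_chi R S) (fun c => #|detects c|).
Proof. exact: euler_integral_height. Qed.

(** [K] is fixed before [m] and the probability space, which may vary with [m]; the real [e] records
    that the expectation is finite. *)
Lemma expectation_euler_integral (S_neq0 : S != fset0) :
  exists2 K : R, 0 <= K &
  forall (m : nat) d (T : measurableType d) (P : probability T R)
    (X : 'I_(m * #|` S|) -> T -> S),
    (0 < m)%N -> uniform_placement P X ->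
  exists2 e : R,
    ('E_P[fun w => euler_integral
      (height S (fun k => target_at shape (val (X k w))))] * (m%:R^-1)%:E)%E
    = e%:E &
    `|e - euler_integral (height S (fun c : S => target_at shape (val c)))|
      <= K / Num.sqrt m%:R.
Proof.
rewrite euler_integral_one_per_sensor; set F := choquet _.
set H := F _; set q : R := #|` S|%:R.
pose L : R := 2 * \sum_A `|@region_chi R S A|.
have S_gt0 : (0 < #|{: S}|)%N by rewrite -cardfE cardfs_gt0.
have qE : q = #|{: S}|%:R by rewrite /q cardfE.
have q_gt0 : 0 < q by rewrite qE ltr0n.
have L_ge0 : 0 <= L by rewrite mulr_ge0// sumr_ge0.
have q_ge0 := ltW q_gt0.
(* Lipschitz constant [L], times [q] cells, each with mean deviation at most [(q + 1) * sqrt m]. *)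
exists (L * (q * (q + 1))); first by rewrite mulr_ge0// mulr_ge0// addr_ge0.
move=> m d T P X m_gt0 X_unif; set n := (m * _)%N in X X_unif *.
have nE : n = (m * #|{: S}|)%N by rewrite /n cardfE.
have mR_gt0 : 0 < m%:R :> R by rewrite ltr0n.
pose u (g : {ffun 'I_n -> S}) c := #|[pred k | detects c (g k)]|.
exists (q^-1 ^+ n * (\sum_g F (u g)) / m%:R).
  under [X in ('E_P[X])%E]eq_fun => w.
    rewrite euler_integral_placement.
    rewrite (_ : (fun c => _) = u [ffun k => X k w]); last first.
      by apply/funext => c; apply: eq_card => k; rewrite !inE ffunE.
    over.
  by rewrite (expectation_uniform_placement X_unif (fun g => F (u g))).
have sumH : \sum_(g : {ffun 'I_n -> S}) m%:R * H = m%:R * H * q ^+ n.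
  by rewrite sumr_const card_ffun card_ord -[LHS]mulr_natr natrX -qE.
have -> : q^-1 ^+ n * (\sum_g F (u g)) / m%:R - H =
    q^-1 ^+ n * (\sum_g (F (u g) - m%:R * H)) / m%:R.
  rewrite sumrB sumH exprVn; field.
  by rewrite !gt_eqF ?exprn_gt0.
set t := Num.sqrt m%:R.
have t_gt0 : 0 < t :> R by rewrite sqrtr_gt0.
have tt : t ^+ 2 = m%:R by rewrite sqr_sqrtr ?ler0n.
have sum_dev : `|\sum_g (F (u g) - m%:R * H)|
    <= L * (q * (q ^+ n * ((q + 1) * t))).
  apply: le_trans (ler_norm_sum _ _ _) _.
  apply: (@le_trans _ _ (\sum_g L * \sum_c
      `|(u g c)%:R - (m * #|detects c|)%N%:R|)).
    (* By homogeneity [m * H] is the Choquet integral of the mean counts, so the Lipschitz bound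
       applies. *)
    apply: ler_sum => g _; rewrite /H /F -choquetZ; last exact: region_chi_set0.
    by apply: choquet_lipschitz; exact: region_chi_set0.
  rewrite -mulr_sumr ler_wpM2l// exchange_big/=.
  rewrite [q in q * _]qE mulr_natl -sumr_const.
  by apply: ler_sum => c _; rewrite qE sum_ffun_count_deviation.
rewrite !normrM normfV normr_nat ger0_norm ?exprn_ge0 ?invr_ge0//.
rewrite ler_pdivrMr// exprVn mulrC ler_pdivrMr ?exprn_gt0//.
apply: (le_trans sum_dev); rewrite le_eqVlt -tt; apply/orP; left.
by apply/eqP; field; rewrite gt_eqF.
Qed.

End Expectation.

(** The asymptotic equality is read as convergence of the expectation divided by [m] to [H]. *)
Theorem theorem2p5 (R : realType) (S : {fset cell}) (S_neq0 : S != fset0)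
    (shape : set (R * R))
    (d : nat -> measure_display) (T : forall m, measurableType (d m))
    (P : forall m, probability (T m) R)
    (X : forall m, 'I_(m * #|` S|) -> T m -> S)
    (X_unif : forall m, (0 < m)%N -> uniform_placement (P m) (X m)) :
  let H : R := euler_integral
    (height S (fun c : S => target_at shape (val c))) in
  let h (m : nat) (w : T m) : R * R -> nat :=
    height S (fun k : 'I_(m * #|` S|) => target_at shape (val (X m k w))) in
  ('E_(P m)[fun w => euler_integral (h m w)] * (m%:R^-1)%:E)%E
    @[m --> \oo] --> H%:E.
Proof.
move=> H h.
have [K K_ge0 HK] := expectation_euler_integral shape S_neq0.
apply: cvg_EFin.
  near=> m; have m_gt0 : (0 < m)%N by near: m; exact: nbhs_infty_gt.
  by have [e -> _] := HK m _ _ _ _ m_gt0 (X_unif m m_gt0).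
apply/cvgrPdist_le => eps eps_gt0; near=> m.
have m_gt0 : (0 < m)%N by near: m; exact: nbhs_infty_gt.
rewrite /= distrC.
have [e -> /le_trans-> //=] := HK m _ _ _ _ m_gt0 (X_unif m m_gt0).
(* [K / sqrt m <= eps] holds once [m] exceeds [(K / eps) ^+ 2]. *)
rewrite ler_pdivrMr ?sqrtr_gt0 ?ltr0n// mulrC -ler_pdivrMr//.
rewrite -[leLHS]ger0_norm ?divr_ge0 ?(ltW eps_gt0)// -sqrtr_sqr.
by rewrite ler_sqrt ?ler0n// ltW//; near: m; exact: nbhs_infty_gtr.
Unshelve. all: by end_near. Qed.
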